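(* Let $X$ be a finite nonempty set, let $\mathcal E^0$ be a nonempty collection of nonempty subsets of $X$, and for each $E\in\mathcal E^0$ let $\mu_E\colon 2^E\to[0,1]$ be a normalized capacity on $E$. There exists a normalized capacity $\mu$ on $X$ satisfying $$\mu(B)=\mu_E(B)\qquad\text{for all }E\in\mathcal E^0\text{ and } B\subseteq E$$ if and only if the family $\{\mu_E:E\in\mathcal E^0\}$ is overlap compatible, i.e. $\mu_E(B)=\mu_F(B)$ for all $E,F\in\mathcal E^0$ and all $B\subseteq E\cap F$. If the family $\{\mu_E:E\in\mathcal E^0\}$ is overlap compatible, put $\mathcal D_0:=\bigcup_{E\in\mathcal E^0}2^E$ and $\mathcal D:=\mathcal D_0\cup\{X\}$, and define $\nu\colon\mathcal D\to[0,1]$ by letting $\nu(B)$ be the common value of $\mu_E(B)$ over all $E\in\mathcal E^0$ with $B\subseteq E$, for $B\in\mathcal D_0$, and $\nu(X)=1$ when $X\notin\mathcal D_0$. Then the least and greatest (in the pointwise order) normalized capacities $\mu$ on $X$ satisfying $\mu(B)=\mu_E(B)$ for all $E\in\mathcal E^0$ and all $B\subseteq E$ are, respectively, $$\nu_*(A)=\max\{\nu(B):B\in\mathcal D,\ B\subseteq A\},\qquad \nu^*(A)=\min\{\nu(C):C\in\mathcal D,\ A\subseteq C\},\qquad A\subseteq X.$$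
   Context: A normalized capacity on a finite nonempty set $Y$ is a map $\mu\colon 2^Y\to[0,1]$ with $\mu(\emptyset)=0$, $\mu(Y)=1$, and $\mu(A)\le\mu(B)$ whenever $A\subseteq B\subseteq Y$. *)

(* Defs.v *)
From mathcomp Require Import boolp classical_sets reals.
(* Loaded after classical_sets, so that set0, setT, etc. denote finite sets. *)
From mathcomp Require Import all_boot all_order all_algebra.

Set Implicit Arguments.
Unset Strict Implicit.
Unset Printing Implicit Defensive.

Import Order.TTheory GRing.Theory Num.Theory.
Local Open Scope ring_scope.

Section Capacities.
Variables (R : realType) (X : finType).
Implicit Types (Y A B C E F : {set X}) (m nu : {set X} -> R).

(* A map 2^Y -> [0,1] is encoded as a function on all of {set X} of which only
   the values at subsets of Y are ever constrained or used. *)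
Definition normalized_capacity Y m : Prop :=
  [/\ (forall A, A \subset Y -> 0 <= m A <= 1),
      m set0 = 0,
      m Y = 1
    & forall A B, A \subset B -> B \subset Y -> m A <= m B].

Variables (E0 : {set {set X}}) (mu : {set X} -> {set X} -> R).

Definition overlap_compatible : Prop :=
  forall E F, E \in E0 -> F \in E0 ->
  forall B, B \subset E :&: F -> mu E B = mu F B.

Definition capacity_extension : set ({set X} -> R) :=
  fun m => normalized_capacity [set: X] m /\
    forall E, E \in E0 -> forall B, B \subset E -> m B = mu E B.

Definition local_domain : {set {set X}} := \bigcup_(E in E0) powerset E.

Definition glued_domain : {set {set X}} := local_domain :|: [set [set: X]].

(* The chosen E is immaterial under overlap compatibility, see glueE. The value
   1 is meant for X when X is not in local_domain; the values outside
   glued_domain are irrelevant. *)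
Definition glue B : R :=
  if [pick E in E0 | B \subset E] is Some E then mu E B else 1.

Lemma glueE : overlap_compatible ->
  forall E B, E \in E0 -> B \subset E -> glue B = mu E B.
Proof.
move=> ov E B EE0 BE; rewrite /glue; case: pickP => [F /andP[FE0 BF]|/(_ E)].
  by apply: ov => //; rewrite subsetI BF.
by rewrite EE0 BE.
Qed.

Lemma glueT : [set: X] \notin local_domain -> glue [set: X] = 1.
Proof.
move=> XD; rewrite /glue; case: pickP => [F /andP[FE0 XF]|//].
by case/negP: XD; apply/bigcupP; exists F => //; rewrite powersetE.
Qed.

(* The seeds are terms of the respective families: set0 lies in glued_domain
   as soon as E0 is nonempty, and [set: X] always does. *)
Definition lower_envelope : {set X} -> R := fun A =>
  \big[Num.max/glue set0]_(B in glued_domain | B \subset A) glue B.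

Definition upper_envelope : {set X} -> R := fun A =>
  \big[Num.min/glue [set: X]]_(C in glued_domain | A \subset C) glue C.

End Capacities.

(* Functions into R carry the pointwise order of boolp. *)
Definition is_least d (T : porderType d) (S : set T) (x : T) : Prop :=
  S x /\ lbound S x.

Definition is_greatest d (T : porderType d) (S : set T) (x : T) : Prop :=
  S x /\ ubound S x.

(* Main.v *)
(** Overlap compatibility makes nu well defined and monotone on the glued
    domain, which contains the empty set and X. Every extension of nu then lies
    between its lower and upper envelopes, and each envelope is itself monotone
    and agrees with nu on the glued domain. *)
Require Import Defs.
From mathcomp Require Import boolp classical_sets reals.
From mathcomp Require Import all_boot all_order all_algebra.

Set Implicit Arguments.
Unset Strict Implicit.
Unset Printing Implicit Defensive.

Import Order.TTheory GRing.Theory Num.Theory.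
Local Open Scope ring_scope.

Section MonotoneEnvelopes.
Variables (R : realType) (X : finType) (E0 : {set {set X}}).
Implicit Types (A B C E : {set X}) (m : {set X} -> R) (r : R).
Variable mu : {set X} -> {set X} -> R.
Hypothesis E0_neq0 : E0 != set0.
Local Notation D := (glued_domain E0).
Local Notation nu := (glue E0 mu).
Local Notation lower := (lower_envelope E0 mu).
Local Notation upper := (upper_envelope E0 mu).

Lemma in_glued_domain E B : E \in E0 -> B \subset E -> B \in D.
Proof.
by move=> EE0 BE; rewrite inE; apply/orP; left; apply/bigcupP; exists E;
  rewrite ?powersetE.
Qed.

Lemma setT_in_glued_domain : [set: X] \in D.
Proof. by rewrite !inE eqxx orbT. Qed.

Lemma set0_in_glued_domain : set0 \in D.
Proof.
by have /set0Pn[E EE0] := E0_neq0; apply: in_glued_domain EE0 (sub0set E).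
Qed.

Lemma glued_domainP B :
  B \in D -> (exists2 E, E \in E0 & B \subset E) \/ B = [set: X].
Proof.
rewrite 2!inE => /orP[/bigcupP[E EE0]|/eqP]; last by right.
by rewrite powersetE; left; exists E.
Qed.

Lemma lower_envelope_ge A B : B \in D -> B \subset A -> nu B <= lower A.
Proof. by move=> BD BA; apply: le_bigmax_cond; rewrite BD. Qed.

(** Paired with [lower_envelope_ge], this characterizes the maximum, so the big operator need not be
    unfolded again. The seed [nu set0] is covered by the bound because [set0] is itself a competitor
    below every [A]; dually, [[set: X]] is one for the minimum. *)
Lemma lower_envelope_le A r :
  (forall B, B \in D -> B \subset A -> nu B <= r) -> lower A <= r.
Proof.
move=> le_r; apply: bigmax_le => [|B /andP[]]; last exact: le_r.
by rewrite le_r ?sub0set ?set0_in_glued_domain.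
Qed.

Lemma upper_envelope_le A C : C \in D -> A \subset C -> upper A <= nu C.
Proof. by move=> CD AC; apply: bigmin_le_cond; rewrite CD. Qed.

Lemma upper_envelope_ge A r :
  (forall C, C \in D -> A \subset C -> r <= nu C) -> r <= upper A.
Proof.
move=> ge_r; apply: le_bigmin => [|C /andP[]]; last exact: ge_r.
by rewrite ge_r ?subsetT ?setT_in_glued_domain.
Qed.

Lemma le_lower_envelope A B : A \subset B -> lower A <= lower B.
Proof.
move=> AB; apply: lower_envelope_le => C CD CA.
by rewrite lower_envelope_ge ?(subset_trans CA).
Qed.

Lemma le_upper_envelope A B : A \subset B -> upper A <= upper B.
Proof.
move=> AB; apply: upper_envelope_ge => C CD BC.
by rewrite upper_envelope_le ?(subset_trans AB).
Qed.

Hypothesis mu_capacity : forall E, E \in E0 -> normalized_capacity E (mu E).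
Hypothesis mu_compatible : overlap_compatible E0 mu.

Lemma glue_setT : nu [set: X] = 1.
Proof.
have [/bigcupP[E EE0]|/glueT->//] := boolP ([set: X] \in local_domain E0).
(* A member of [E0] that contains X is X itself, so its normalization gives the value 1. *)
rewrite powersetE subTset => /eqP ET; have [_ _ muE _] := mu_capacity EE0.
by rewrite ET in EE0 muE; rewrite (glueE mu_compatible EE0).
Qed.

Lemma glue_set0 : nu set0 = 0.
Proof.
have /set0Pn[E EE0] := E0_neq0; have [_ mu0 _ _] := mu_capacity EE0.
by rewrite (glueE mu_compatible EE0) ?sub0set.
Qed.

(** Any [E] that contains [C] also contains [B], so both values can be read from the single capacity
    [mu E]. If no [E] is supplied, [C] is X, whose value 1 bounds all others. *)
Lemma le_glue B C : B \in D -> C \in D -> B \subset C -> nu B <= nu C.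
Proof.
move=> BD /glued_domainP[[E EE0 CE]|->] BC.
  have [_ _ _ muE_le] := mu_capacity EE0.
  by rewrite !(glueE mu_compatible EE0) ?muE_le ?(subset_trans BC).
have [[E EE0 BE]|->//] := glued_domainP BD.
have [/(_ B BE)/andP[_ muB_le1] _ _ _] := mu_capacity EE0.
by rewrite glue_setT (glueE mu_compatible EE0).
Qed.

(** [B] competes in its own maximum, and monotonicity of [nu] on [D] keeps every other competitor
    below it. *)
Lemma lower_envelope_glue B : B \in D -> lower B = nu B.
Proof.
move=> BD; apply: le_anti; rewrite lower_envelope_ge // andbT.
by apply: lower_envelope_le => C CD CB; apply: le_glue.
Qed.

Lemma upper_envelope_glue B : B \in D -> upper B = nu B.
Proof.
move=> BD; apply: le_anti; rewrite upper_envelope_le //=.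
by apply: upper_envelope_ge => C CD BC; apply: le_glue.
Qed.

(** Common criterion for both envelopes. *)
Lemma monotone_capacity_extension m :
    (forall A B, A \subset B -> m A <= m B) ->
    (forall B, B \in D -> m B = nu B) ->
  capacity_extension E0 mu m.
Proof.
move=> m_le m_nu.
have m0 : m set0 = 0 by rewrite m_nu ?glue_set0 ?set0_in_glued_domain.
have mT : m [set: X] = 1 by rewrite m_nu ?glue_setT ?setT_in_glued_domain.
split=> [|E EE0 B BE].
  split=> // [A _|A B AB _]; last exact: m_le.
  (* The range [0,1] follows from monotonicity between the empty set and X. *)
  by rewrite -m0 -mT !m_le ?sub0set ?subsetT.
by rewrite m_nu ?(in_glued_domain EE0) ?(glueE mu_compatible EE0).
Qed.

(** Normalization of [m] settles the value at X, so adjoining X to the domain imposes no new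
    constraint on extensions. *)
Lemma capacity_extension_glue m B :
  capacity_extension E0 mu m -> B \in D -> m B = nu B.
Proof.
move=> [[_ _ mT _] m_mu] /glued_domainP[[E EE0 BE]|->].
  by rewrite (m_mu E) // (glueE mu_compatible EE0).
by rewrite mT glue_setT.
Qed.

Lemma lower_envelope_least :
  is_least (capacity_extension E0 mu) (lower_envelope E0 mu).
Proof.
split=> [|m m_ext].
  apply: monotone_capacity_extension lower_envelope_glue.
  exact: le_lower_envelope.
have [[_ _ _ m_le] _] := m_ext.
(* Each competitor satisfies [nu B = m B <= m A]; the upper bound is dual. *)
apply/lefP => A; apply: lower_envelope_le => B BD BA.
by rewrite -(capacity_extension_glue m_ext) ?m_le ?subsetT.
Qed.

Lemma upper_envelope_greatest :
  is_greatest (capacity_extension E0 mu) (upper_envelope E0 mu).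
Proof.
split=> [|m m_ext].
  apply: monotone_capacity_extension upper_envelope_glue.
  exact: le_upper_envelope.
have [[_ _ _ m_le] _] := m_ext.
apply/lefP => A; apply: upper_envelope_ge => C CD AC.
by rewrite -(capacity_extension_glue m_ext) ?m_le ?subsetT.
Qed.

End MonotoneEnvelopes.

(** On a common subset [B], both local values equal [m B]. *)
Lemma capacity_extension_compatible (R : realType) (X : finType)
    (E0 : {set {set X}}) (mu : {set X} -> {set X} -> R) m :
  capacity_extension E0 mu m -> overlap_compatible E0 mu.
Proof.
move=> [_ m_mu] E F EE0 FE0 B; rewrite subsetI => /andP[BE BF].
by rewrite -(m_mu E) // -(m_mu F).
Qed.

Theorem corollary5p3 (R : realType) (X : finType) (X_nonempty : (0 < #|X|)%N)
    (E0 : {set {set X}}) (E0_nonempty : E0 != set0)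
    (E_nonempty : forall E : {set X}, E \in E0 -> E != set0)
    (mu : {set X} -> {set X} -> R)
    (mu_capacity : forall E : {set X}, E \in E0 -> normalized_capacity E (mu E)) :
  ((exists m : {set X} -> R, capacity_extension E0 mu m) <->
     overlap_compatible E0 mu) /\
  (overlap_compatible E0 mu ->
     is_least (capacity_extension E0 mu) (lower_envelope E0 mu) /\
     is_greatest (capacity_extension E0 mu) (upper_envelope E0 mu)).
Proof.
split=> [|ov]; last first.
  by split; [exact: lower_envelope_least|exact: upper_envelope_greatest].
split=> [[m]|ov]; first exact: capacity_extension_compatible.
by exists (lower_envelope E0 mu); have [] := lower_envelope_least _ _ ov.
Qed.
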